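(* $\mathsf{PK}_{\mathbb{N}^{\mathbb{N}}}<_{\mathrm{W}}\mathsf{ScList}_{\mathbb{N}^{\mathbb{N}}}$.
   Context: A represented space is a set $X$ with a partial surjection $\delta_X:\subseteq\mathbb{N}^{\mathbb{N}}\to X$; $p$ is a name of $x$ if $\delta_X(p)=x$. A problem is a partial multi-valued function $f:\subseteq X\rightrightarrows Y$ between represented spaces. $f\le_{\mathrm{W}} g$ (Weihrauch reducibility) means that there are computable partial maps $\Phi,\Psi:\subseteq\mathbb{N}^{\mathbb{N}}\to\mathbb{N}^{\mathbb{N}}$ such that for every name $p$ of some $x\in\mathrm{dom}(f)$, $\Phi(p)$ is a name of some $y\in\mathrm{dom}(g)$, and for every name $q$ of an element of $g(y)$, $\Psi(p*q)$ is a name of an element of $f(x)$, where $p*q$ is the interleaving of $p$ and $q$. $f<_{\mathrm{W}}g$ means $f\le_{\mathrm{W}}g$ and $g\not\le_{\mathrm{W}}f$. A tree is a nonempty subset $T$ of $\mathbb{N}^{<\mathbb{N}}$ closed under initial segments; $[T]$ is its set of infinite paths. $\mathcal{A}(\mathbb{N}^{\mathbb{N}})$ is the space of closed subsets of Baire space, a name of $C$ being (the characteristic function of) a tree $T$ with $[T]=C$; this is equivalent to the usual negative representation. $\mathbb{N}$, $2=\{0,1\}$, $\mathbb{N}^{\mathbb{N}}$, products and sequence spaces carry the standard representations. A closed set is perfect if it has no isolated points; the perfect kernel of a closed set $A$ is the unique perfect $P\subseteq A$ with $A\setminus P$ countable. $\mathsf{PK}_{\mathbb{N}^{\mathbb{N}}}:\mathcal{A}(\mathbb{N}^{\mathbb{N}})\to\mathcal{A}(\mathbb{N}^{\mathbb{N}})$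 maps a closed set to its perfect kernel. $\mathsf{ScList}_{\mathbb{N}^{\mathbb{N}}}:\mathcal{A}(\mathbb{N}^{\mathbb{N}})\rightrightarrows\mathbb{N}\times(2\times\mathbb{N}^{\mathbb{N}})^{\mathbb{N}}$ is defined on every closed set $A$; its solutions are all $(n,(b_i,x_i)_{i\in\mathbb{N}})$ such that $A\setminus\mathsf{PK}_{\mathbb{N}^{\mathbb{N}}}(A)=\{x_i:b_i=1\}$, and $n=0$ if $A\setminus\mathsf{PK}_{\mathbb{N}^{\mathbb{N}}}(A)$ is infinite, while $n=|A\setminus\mathsf{PK}_{\mathbb{N}^{\mathbb{N}}}(A)|+1$ if it is finite. *)

(* Defs.v *)
From HB Require Import structures.
From Stdlib Require Cantor.
From mathcomp Require Import all_boot.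
From mathcomp Require Import all_classical topology.

Set Implicit Arguments.
Unset Strict Implicit.
Unset Printing Implicit Defensive.

Local Open Scope classical_set_scope.

Definition baire : Type := prod_topology (fun _ : nat => nat).

HB.instance Definition _ := Pointed.on baire.
HB.instance Definition _ := Nbhs.on baire.
HB.instance Definition _ := Topological.on baire.

(** Kleene's partial recursive functions relative to an oracle [p : baire].
    Arguments are passed as a list; reading beyond its end yields [0], so no
    arities have to be tracked. *)

Inductive code : Type :=
| Zero
| Succ
| Proj of nat
| Oracle
| Comp of code & seq code
| PrimRec of code & code
| Mu of code.

Definition pointwise (A B : Type) (R : A -> B -> Prop) :
    seq A -> seq B -> Prop :=
  fix pw xs ys :=
    match xs, ys with
    | [::], [::] => True
    | x :: xs', y :: ys' => R x y /\ pw xs' ys'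
    | _, _ => False
    end.

Fixpoint iterate (base : nat -> Prop) (step : nat -> nat -> nat -> Prop)
    (n v : nat) : Prop :=
  match n with
  | 0 => base v
  | m.+1 => exists w, iterate base step m w /\ step m w v
  end.

(** [eval p c s v]: the computation of [c] with oracle [p] on the arguments [s]
    halts with value [v]. The recursion variable of [PrimRec] and the search
    variable of [Mu] are the first argument; the step function of [PrimRec]
    gets the counter, the previous value and the parameters. *)
Fixpoint eval (p : baire) (c : code) (s : seq nat) (v : nat) {struct c} : Prop :=
  match c with
  | Zero => v = 0
  | Succ => v = (nth 0 s 0).+1
  | Proj i => v = nth 0 s i
  | Oracle => v = p (nth 0 s 0)
  | Comp f gs =>
      exists ws, pointwise (fun g w => eval p g s w) gs ws /\ eval p f ws v
  | PrimRec f g =>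
      match s with
      | [::] => False
      | n :: s' =>
          iterate (eval p f s') (fun m w => eval p g [:: m, w & s']) n v
      end
  | Mu f =>
      eval p f (v :: s) 0 /\ forall m, m < v -> exists w, eval p f (m :: s) w.+1
  end.

(** As usual in computable analysis, the program may behave arbitrarily on
    inputs outside the domain of the map. *)
Definition computable_map (F : baire -> option baire) : Prop :=
  exists c : code, forall p q : baire,
    F p = Some q -> forall n, eval p c [:: n] (q n).

(** [names p x] is the graph of the partial surjection: [p] is a name of [x]. *)
Record repSpace := RepSpace {
  carrier :> Type;
  names : baire -> carrier -> Prop;
  names_functional : forall p x y, names p x -> names p y -> x = y;
  names_surjective : forall x, exists p, names p x
}.

Definition interleave (p q : baire) : baire :=
  fun n => if odd n then q n./2 else p n./2.

Definition evens (p : baire) : baire := fun n => p n.*2.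
Definition odds (p : baire) : baire := fun n => p n.*2.+1.

Lemma interleaveK1 (p q : baire) : evens (interleave p q) = p.
Proof.
by apply/funext => n; rewrite /evens /interleave odd_double doubleK.
Qed.

Lemma interleaveK2 (p q : baire) : odds (interleave p q) = q.
Proof.
by apply/funext => n; rewrite /odds /interleave /= odd_double /= uphalf_double.
Qed.

Definition row (p : baire) (i : nat) : baire := fun j => p (Cantor.to_nat (i, j)).

Local Obligation Tactic := idtac.

Program Definition rep_nat : repSpace :=
  @RepSpace nat (fun p n => p 0 = n) _ _.
Next Obligation. by move=> p x y <- <-. Qed.
Next Obligation. by move=> x; exists (fun=> x). Qed.

Program Definition rep_bool : repSpace :=
  @RepSpace bool (fun p b => p 0 = nat_of_bool b) _ _.
Next Obligation. by move=> p [] [] -> . Qed.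
Next Obligation. by move=> x; exists (fun=> nat_of_bool x). Qed.

Program Definition rep_baire : repSpace :=
  @RepSpace baire (fun p x => p = x) _ _.
Next Obligation. by move=> p x y <- <-. Qed.
Next Obligation. by move=> x; exists x. Qed.

Program Definition rep_prod (X Y : repSpace) : repSpace :=
  @RepSpace (X * Y)%type
    (fun p xy => names (evens p) xy.1 /\ names (odds p) xy.2) _ _.
Next Obligation.
move=> X Y p [x y] [x' y'] /= [px py] [px' py'].
by congr (_, _); [exact: names_functional px px'|exact: names_functional py py'].
Qed.
Next Obligation.
move=> X Y [x y].
have [p px] := names_surjective x; have [q qy] := names_surjective y.
by exists (interleave p q); rewrite interleaveK1 interleaveK2.
Qed.

Program Definition rep_seq (X : repSpace) : repSpace :=
  @RepSpace (nat -> X) (fun p u => forall i, names (row p i) (u i)) _ _.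
Next Obligation.
move=> X p u v pu pv; apply/funext => i; exact: names_functional (pu i) (pv i).
Qed.
Next Obligation.
move=> X u; have /choice[f fu] := fun i => names_surjective (u i).
exists (fun n => f (Cantor.of_nat n).1 (Cantor.of_nat n).2) => i.
rewrite (_ : row _ i = f i)//.
by apply/funext => j; rewrite /row Cantor.cancel_of_to.
Qed.

Definition is_tree (T : set (seq nat)) : Prop :=
  T !=set0 /\ forall s t, prefix s t -> T t -> T s.

Definition body (T : set (seq nat)) : set baire :=
  [set x | forall n, T (mkseq x n)].

(** Finite strings are identified with natural numbers through the bijection
    [CodeSeq.code]. *)
Definition is_charfun (p : baire) (T : set (seq nat)) : Prop :=
  forall s, p (CodeSeq.code s) = nat_of_bool `[< T s >].

Definition closed_set : Type := {A : set baire | closed A}.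

Definition tree_name (p : baire) (A : closed_set) : Prop :=
  exists T, [/\ is_tree T, is_charfun p T & body T = sval A].

Lemma nbhs_baireP (x : baire) (U : set baire) :
  nbhs x U <-> exists n, [set y : baire | mkseq y n = mkseq x n] `<=` U.
Proof.
split=> [xU|[n nU]].
  apply: contrapT => /forallNP /(_ _) /nonsubset noU.
  have /choice[y yP] := noU.
  have /(_ U xU)[N _ /(_ N (leqnn N))] : (y n @[n --> \oo] --> x).
    apply/cvg_sup => k V [_ [[W oW <-] Wxk WV]].
    apply: (filterS WV); exists k.+1 => // n /= kn.
    have [/= /(congr1 (fun s => nth 0 s k)) + _] := yP n.
    by rewrite !nth_mkseq// => ->.
  by have [_] := yP N.
apply: filterS nU _; elim: n => [|n IHn].
  by apply: filterS filterT => y _.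
have xn : nbhs x [set y : baire | y n = x n].
  apply: (@proj_continuous nat (fun=> nat) n x [set m | m = x n]).
  by rewrite nbhs_principalE; exact/principal_filterP.
by apply: filterS2 IHn xn => y /= yx ynx; rewrite !mkseqS yx ynx.
Qed.

Lemma prefix_mkseq (x : baire) (s : seq nat) (n : nat) :
  prefix s (mkseq x n) -> s = mkseq x (size s).
Proof.
rewrite prefixE => /eqP sE.
have sn : size s <= n by rewrite -sE size_take_min size_mkseq geq_minr.
by rewrite -[LHS]sE /mkseq -map_take take_iota (minn_idPl sn).
Qed.

Lemma tree_name_functional (p : baire) (A B : closed_set) :
  tree_name p A -> tree_name p B -> A = B.
Proof.
move=> [S [_ pS SA]] [T [_ pT TB]].
case: A B SA TB => A cA [B cB] /= SA TB; apply: eq_exist; rewrite -SA -TB.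
congr body; apply/funext => s; apply/propext.
by have := pS s; rewrite pT; do 2!case: asboolP.
Qed.

Lemma tree_name_surjective (A : closed_set) : exists p, tree_name p A.
Proof.
pose T : set (seq nat) :=
  [set s | s = [::] \/ exists2 x, sval A x & s = mkseq x (size s)].
exists (fun n => nat_of_bool `[< T (CodeSeq.decode n) >]); exists T; split.
- split; first by exists [::]; left.
  move=> s t st [t0|[x Ax tx]].
    by left; move: st; rewrite t0 prefixs0 => /eqP.
  by right; exists x => //; move: st; rewrite tx; exact: prefix_mkseq.
- by move=> s; rewrite CodeSeq.codeK.
- apply/seteqP; split => [x xT|x Ax n]; last first.
    by right; exists x => //; rewrite size_mkseq.
  apply: (svalP A) => U /nbhs_baireP[k kU].
  have [//|[y Ay]] := xT k.+1; rewrite size_mkseq => xy.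
  exists y; split=> //; apply: kU => /=.
  by move: xy; rewrite !mkseqS => /rcons_inj[->].
Qed.

Definition rep_closed : repSpace :=
  RepSpace tree_name_functional tree_name_surjective.

(** A partial multi-valued function; its domain is the set of the points that
    have at least one solution. *)
Definition problem (X Y : repSpace) : Type := X -> set Y.

Definition dom (X Y : repSpace) (f : problem X Y) : set X :=
  [set x | f x !=set0].

Definition weihrauch_le (X Y U V : repSpace)
    (f : problem X Y) (g : problem U V) : Prop :=
  exists Phi Psi : baire -> option baire,
    [/\ computable_map Phi, computable_map Psi &
      forall (p : baire) (x : X), names p x -> dom f x ->
        exists (p' : baire) (u : U),
          [/\ Phi p = Some p', names p' u, dom g u &
            forall (q : baire) (v : V), names q v -> g u v ->
              exists (q' : baire) (y : Y),
                [/\ Psi (interleave p q) = Some q', names q' y & f x y]]].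

Definition weihrauch_lt (X Y U V : repSpace)
    (f : problem X Y) (g : problem U V) : Prop :=
  weihrauch_le f g /\ ~ weihrauch_le g f.

Notation "f <=_W g" := (weihrauch_le f g) (at level 70, no associativity).
Notation "f <_W g" := (weihrauch_lt f g) (at level 70, no associativity).

Definition is_perfect_kernel (A P : set baire) : Prop :=
  [/\ perfect_set P, P `<=` A & countable (A `\` P)].

Definition PK : problem rep_closed rep_closed :=
  fun A => [set P | is_perfect_kernel (sval A) (sval P)].

Definition ScList :
    problem rep_closed (rep_prod rep_nat (rep_seq (rep_prod rep_bool rep_baire))) :=
  fun A => [set nbx | exists2 P, PK A P &
    let D := sval A `\` sval P in
    D = [set x | exists i, (nbx.2 i).1 = true /\ (nbx.2 i).2 = x] /\
    ((infinite_set D /\ nbx.1 = 0) \/ exists2 k, (D #= `I_k)%card & nbx.1 = k.+1)].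

(* Main.v *)
From Stdlib Require Cantor.
From mathcomp Require Import all_boot.
From mathcomp Require Import all_classical topology.
From mathcomp Require Import zify.
Require Import Defs.

(** For a sequence of trees [W c], the closed set of all [c 0^w] and all
    [c 0^n a y] with [a > 0] and [y] a branch of [W c] (blown up so that no such
    branch is isolated) has [{c 0^w : W c is well-founded}] as its scattered part.

    Reduction of [PK] to [ScList]: let the branches of [W c] be the Cantor schemes
    of strings in the tree of [A] above the string coded by [c]. Then [W c] is
    well-founded iff the cone of that string misses the perfect kernel, so a list
    of the scattered part enumerates the complement of the kernel.

    No converse reduction: it would compute the cardinality component of [ScList]
    from a name of a perfect kernel [C]. That the component equals 1 is then
    witnessed by a finite part of such a name, that is, by a finite part whose
    excluded cones all miss [C]; and "the cone meets [C]" is witnessed by a scheme.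
    Hence "the component is not 1" is analytic. For the fan of constant [W] it says
    that [W] is well-founded, and well-foundedness is not analytic, by
    diagonalization. *)

Set Implicit Arguments.
Unset Strict Implicit.
Unset Printing Implicit Defensive.

Local Open Scope classical_set_scope.

(** * Computable functions *)

(* The number of arguments is fixed because [Comp] can only pass on finitely many. *)
Definition recf (k : nat) (F : baire -> seq nat -> nat) : Prop :=
  exists c, forall p s, size s = k -> eval p c s (F p s).

Definition recp (k : nat) (B : baire -> seq nat -> bool) : Prop :=
  recf k (fun p s => nat_of_bool (B p s)).

Lemma recf_ext k F G : (forall p s, F p s = G p s) -> recf k F -> recf k G.
Proof. by move=> FG [c cF]; exists c => p s sk; rewrite -FG; exact: cF. Qed.

Lemma recf_comp k F (Gs : seq (baire -> seq nat -> nat)) :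
  recf (size Gs) F -> foldr (fun G P => recf k G /\ P) True Gs ->
  recf k (fun p s => F p [seq G p s | G <- Gs]).
Proof.
move=> [c cF] recGs.
have [gs gsP] : exists gs, forall p s, size s = k ->
    pointwise (fun g w => eval p g s w) gs [seq G p s | G <- Gs].
  elim: Gs recGs {cF} => [|G Gs IH] /=; first by move=> _; exists [::].
  by case=> -[g gP] /IH[gs gsP]; exists (g :: gs) => p s sk /=; split; auto.
exists (Comp c gs) => p s sk /=; exists [seq G p s | G <- Gs].
by split; [exact: gsP | apply: cF; rewrite size_map].
Qed.

Lemma recf_proj k i : recf k (fun _ s => nth 0 s i).
Proof. by exists (Proj i). Qed.

(** Iterations and bounded quantifiers push their bound variables to the front of the argument list,
    so a variable from further out is read through nested [drop]s. *)
Definition is_drop (t : seq nat -> seq nat) := exists a, forall s, t s = drop a s.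

Lemma is_drop_id : is_drop (fun s => s).
Proof. by exists 0 => s; rewrite drop0. Qed.

Lemma is_drop_drop t a : is_drop t -> is_drop (fun s => drop a (t s)).
Proof. by case=> b tb; exists (a + b) => s; rewrite tb drop_drop. Qed.

Lemma recf_var k t i : is_drop t -> recf k (fun _ s => nth 0 (t s) i).
Proof.
by case=> a ta; exists (Proj (a + i)) => p s _; rewrite /= ta nth_drop.
Qed.

Lemma recf_succ k F : recf k F -> recf k (fun p s => (F p s).+1).
Proof.
move=> recF; apply: (@recf_comp k (fun _ s => (nth 0 s 0).+1) [:: F]) => //.
by exists Succ.
Qed.

Lemma recf_const k n : recf k (fun _ _ => n).
Proof. by elim: n => [|n IHn]; [exists Zero | exact: recf_succ]. Qed.

Lemma recf_oracle k F : recf k F -> recf k (fun p s => p (F p s)).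
Proof.
move=> recF; apply: (@recf_comp k (fun p s => p (nth 0 s 0)) [:: F]) => //.
by exists Oracle.
Qed.

Lemma recf_comp1 h : recf 1 (fun _ s => h (nth 0 s 0)) ->
  forall k F, recf k F -> recf k (fun p s => h (F p s)).
Proof. by move=> recH k F recF; apply: (recf_comp (Gs := [:: F]) recH). Qed.

Lemma recf_comp2 h : recf 2 (fun _ s => h (nth 0 s 0) (nth 0 s 1)) ->
  forall k F G, recf k F -> recf k G -> recf k (fun p s => h (F p s) (G p s)).
Proof.
by move=> recH k F G recF recG; apply: (recf_comp (Gs := [:: F; G]) recH).
Qed.

(** Projections realize [drop]: positions [a], ..., [a + k - 1] are passed on one by one, after the
    values of [Ms]. *)
Lemma recf_comp_drop k a F Ms : recf (size Ms + k) F ->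
  foldr (fun G P => recf (a + k) G /\ P) True Ms ->
  recf (a + k) (fun p s => F p ([seq M p s | M <- Ms] ++ drop a s)).
Proof.
move=> recF recMs.
pose Gs := Ms ++ [seq (fun (_ : baire) s => nth 0 s i) | i <- iota a k].
have recC : recf (a + k) (fun p s => F p [seq G p s | G <- Gs]).
  apply: recf_comp; first by rewrite size_cat size_map size_iota.
  rewrite /Gs; elim: Ms recMs {recF Gs} => [_|M Ms IHMs [recM /IHMs]] //=.
  elim: (iota a k) => //= i r IHr; split=> //; exact: recf_proj.
have [c cP] := recC; exists c => p s sk; have := cP p s sk.
have szd : size (drop a s) = k by rewrite size_drop sk addKn.
rewrite map_cat -map_comp (_ : map _ (iota a k) = drop a s)//.
rewrite -[RHS](mkseq_nth 0) szd -{1}[a]addn0 iotaDl -map_comp.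
by apply: eq_map => i; rewrite /= nth_drop.
Qed.

Lemma recf_drop k a N : recf k N -> recf (a + k) (fun p s => N p (drop a s)).
Proof. by move=> recN; apply: (@recf_comp_drop k a N [::] recN). Qed.

(** For use inside an iteration, whose own variables are the first [a] arguments: [M] may depend on
    them, while [f] receives only the other arguments and the value of [M]. *)
Lemma recf_bind k a f M :
  recf k.+1 (fun p s => f p (drop 1 s) (nth 0 s 0)) -> recf (a + k) M ->
  recf (a + k) (fun p s => f p (drop a s) (M p s)).
Proof.
move=> recf_f recM; have := @recf_comp_drop k a _ [:: M] recf_f (conj recM I).
by apply: recf_ext => p s; rewrite /= drop0.
Qed.

Lemma recf_iteri k N B G : recf k N -> recf k B ->
  recf k.+2 (fun p s => G p (drop 2 s) (nth 0 s 0) (nth 0 s 1)) ->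
  recf k (fun p s => iteri (N p s) (G p s) (B p s)).
Proof.
move=> recN [b bP] [g gP].
pose f p s n := iteri n (G p s) (B p s).
have recf_f : recf k.+1 (fun p s => f p (drop 1 s) (nth 0 s 0)).
  exists (PrimRec b g) => p [//|n s] [sk] /=; rewrite drop0.
  elim: n => [|n IHn] /=; first exact: bP.
  exists (f p s n); split=> //.
  by have := gP p [:: n, f p s n & s]; rewrite /= drop0 sk; exact.
have [c cP] := @recf_bind k 0 f N recf_f recN.
by exists c => p s /(cP p); rewrite drop0.
Qed.

(** The value is found by unbounded search. As [Mu] looks for a zero, the test is first negated, by
    an iteration that turns 1 into 0 when [R] holds. *)
Lemma recf_graph k F R :
  recp k.+1 (fun p s => R p (drop 1 s) (nth 0 s 0)) ->
  (forall p s v, R p s v = (v == F p s)) -> recf k F.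
Proof.
move=> recR RF.
have recNR : recf k.+1 (fun p s => iteri (R p (drop 1 s) (nth 0 s 0))
                                      (fun _ _ => 0) 1).
  by apply: recf_iteri => //; exact: recf_const.
have [c cP] := recNR; exists (Mu c) => p s sk /=.
have cPv v : eval p c (v :: s) (v != F p s).
  have := cP p (v :: s); rewrite /= sk drop0 RF => /(_ erefl).
  by case: (v == _).
split; first by have := cPv (F p s); rewrite eqxx.
by move=> m mF; exists 0; have := cPv m; rewrite ltn_eqF.
Qed.

(** * Arithmetic, Boolean operations and bounded quantifiers *)

Lemma recf_add k F G : recf k F -> recf k G -> recf k (fun p s => F p s + G p s).
Proof.
move=> recF recG.
apply: (@recf_ext _ (fun p s => iteri (F p s) (fun _ w => w.+1) (G p s))).
  by move=> p s; elim: (F p s) => //= n ->.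
by apply: recf_iteri => //; apply: recf_succ; exact: recf_proj.
Qed.

Lemma recf_mul k F G : recf k F -> recf k G -> recf k (fun p s => F p s * G p s).
Proof.
move: k F G; apply: recf_comp2.
pose F (p : baire) s := iteri (nth 0 s 0) (fun _ w => nth 0 s 1 + w) 0.
apply: (@recf_ext _ F).
  by move=> p s; rewrite /F; elim: (nth 0 s 0) => //= n ->; rewrite mulSn.
apply: recf_iteri; [exact: recf_proj|exact: recf_const|].
by apply: recf_add; [exact/recf_var/is_drop_drop/is_drop_id|exact: recf_proj].
Qed.

Lemma recf_pred k F : recf k F -> recf k (fun p s => (F p s).-1).
Proof.
move: k F; apply: recf_comp1.
apply: (@recf_ext _ (fun _ s => iteri (nth 0 s 0) (fun i _ => i) 0)).
  by move=> p s; case: (nth 0 s 0).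
by apply: recf_iteri; [exact: recf_proj|exact: recf_const|exact: recf_proj].
Qed.

Lemma recf_sub k F G : recf k F -> recf k G -> recf k (fun p s => F p s - G p s).
Proof.
move=> recF recG.
apply: (@recf_ext _ (fun p s => iteri (G p s) (fun _ w => w.-1) (F p s))).
  by move=> p s; elim: (G p s) => //= [|n ->]; rewrite ?subn0 ?subnS.
by apply: recf_iteri => //; apply: recf_pred; exact: recf_proj.
Qed.

Lemma recf_exp2 k F : recf k F -> recf k (fun p s => 2 ^ F p s).
Proof.
move=> recF.
apply: (@recf_ext _ (fun p s => iteri (F p s) (fun _ w => 2 * w) 1)).
  by move=> p s; elim: (F p s) => //= n ->; rewrite expnS.
apply: recf_iteri => //; first exact: recf_const.
by apply: recf_mul; [exact: recf_const|exact: recf_proj].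
Qed.

Lemma recp_pos k F : recf k F -> recp k (fun p s => 0 < F p s).
Proof.
move=> recF.
apply: (@recf_ext _ (fun p s => iteri (F p s) (fun _ _ => 1) 0)).
  by move=> p s; case: (F p s).
by apply: recf_iteri => //; exact: recf_const.
Qed.

Lemma recp_neg k B : recp k B -> recp k (fun p s => ~~ B p s).
Proof.
move=> recB.
apply: (@recf_ext _ (fun p s => 1 - B p s)); first by move=> p s; case: (B p s).
by apply: recf_sub => //; exact: recf_const.
Qed.

Lemma recp_and k A B : recp k A -> recp k B -> recp k (fun p s => A p s && B p s).
Proof.
move=> recA recB; apply: (@recf_ext _ (fun p s => A p s * B p s)).
  by move=> p s; rewrite mulnb.
exact: recf_mul.
Qed.

Lemma recp_or k A B : recp k A -> recp k B -> recp k (fun p s => A p s || B p s).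
Proof.
move=> recA recB; apply: (@recf_ext _ (fun p s => ~~ (~~ A p s && ~~ B p s))).
  by move=> p s; rewrite negb_and !negbK.
by apply/recp_neg/recp_and; exact: recp_neg.
Qed.

Lemma recp_imp k A B : recp k A -> recp k B -> recp k (fun p s => A p s ==> B p s).
Proof.
move=> recA recB; apply: (@recf_ext _ (fun p s => ~~ A p s || B p s)).
  by move=> p s; rewrite implybE.
by apply: recp_or => //; exact: recp_neg.
Qed.

Lemma recp_leq k F G : recf k F -> recf k G -> recp k (fun p s => F p s <= G p s).
Proof.
move=> recF recG; apply: (@recf_ext _ (fun p s => ~~ (0 < F p s - G p s))).
  by move=> p s; rewrite subn_gt0 -leqNgt.
by apply/recp_neg/recp_pos; exact: recf_sub.
Qed.

Lemma recp_eq k F G : recf k F -> recf k G -> recp k (fun p s => F p s == G p s).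
Proof.
move=> recF recG.
apply: (@recf_ext _ (fun p s => (F p s <= G p s) && (G p s <= F p s))).
  by move=> p s; rewrite -eqn_leq.
by apply: recp_and; exact: recp_leq.
Qed.

Lemma recp_all k N B :
  recf k N -> recp k.+1 (fun p s => B p (drop 1 s) (nth 0 s 0)) ->
  recp k (fun p s => all (B p s) (iota 0 (N p s))).
Proof.
move=> recN recB.
pose G p s := iteri (N p s) (fun i w => B p s i * w) 1.
apply: (@recf_ext _ G).
  move=> p s; rewrite /G; elim: (N p s) => [//|n IHn].
  by rewrite -addn1 iotaD all_cat /= andbT -mulnb mulnC -IHn addn1.
apply: recf_iteri => //; first exact: recf_const.
apply: recf_mul; last exact: recf_proj.
exact: (@recf_bind k 2 (fun p s i => nat_of_bool (B p s i)) _ recB (recf_proj _ 0)).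
Qed.

Lemma recp_has k N B :
  recf k N -> recp k.+1 (fun p s => B p (drop 1 s) (nth 0 s 0)) ->
  recp k (fun p s => has (B p s) (iota 0 (N p s))).
Proof.
move=> recN recB.
apply: (@recf_ext _ (fun p s => ~~ all (fun i => ~~ B p s i) (iota 0 (N p s)))).
  move=> p s; rewrite -has_predC; congr nat_of_bool.
  by apply: eq_has => i /=; rewrite negbK.
apply/recp_neg/recp_all => //; exact: recp_neg.
Qed.

Ltac rec_step := first
  [ assumption
  | exact: recf_proj | exact: recf_const
  | apply: recf_var; by repeat first [exact: is_drop_id | apply: is_drop_drop]
  | apply: recp_and | apply: recp_or | apply: recp_imp | apply: recp_neg
  | apply: recp_eq | apply: recp_leq | apply: recp_all | apply: recp_has
  | apply: recf_succ | apply: recf_oracle | apply: recf_exp2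
  | apply: recf_add | apply: recf_mul | apply: recf_sub | apply: recf_pred ].

Ltac rec_auto := repeat rec_step.

(** * Computing with strings through their codes *)

Local Notation code := CodeSeq.code.
Local Notation decode := CodeSeq.decode.

Lemma code_cons a s : code (a :: s) = 2 ^ a * (code s + code s).+1.
Proof. by rewrite /= addnn. Qed.

Lemma pow2_odd_inj a b m n :
  2 ^ a * (m + m).+1 = 2 ^ b * (n + n).+1 -> a = b /\ m = n.
Proof.
rewrite -[m]CodeSeq.decodeK -[n]CodeSeq.decodeK -!code_cons.
by move=> /(can_inj CodeSeq.codeK)[-> ->].
Qed.

(** A nonzero code is uniquely [2 ^ a * (m + m).+1] with [a] the head and [m] the code of the tail,
    and [m] is below the code, so the graph is decided by bounded search. The code 0 is the empty
    string, with default head 0. *)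
Lemma recf_head k F :
  recf k F -> recf k (fun p s => head 0 (decode (F p s))).
Proof.
move: k F; apply: (recf_comp1 (h := fun n => head 0 (decode n))).
apply: (@recf_graph _ _ (fun _ s v => (nth 0 s 0 == 0) && (v == 0) ||
  has (fun m => nth 0 s 0 == 2 ^ v * (m + m).+1) (iota 0 (nth 0 s 0)))).
  by rec_auto.
move=> _ s v; rewrite -[nth 0 s 0]CodeSeq.decodeK; move: (decode _) => u.
rewrite CodeSeq.codeK; case: u => [|a u]; first by rewrite /= orbF.
rewrite code_cons /= muln_eq0 expn_eq0 /=; apply/hasP/eqP.
  by case=> m _ /eqP/pow2_odd_inj[].
move=> ->; exists (code u) => //; rewrite mem_iota add0n /=.
by have := expn_gt0 2 a; nia.
Qed.

Lemma recf_behead k F :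
  recf k F -> recf k (fun p s => code (behead (decode (F p s)))).
Proof.
move: k F; apply: (recf_comp1 (h := fun n => code (behead (decode n)))).
apply: (@recf_graph _ _ (fun _ s v => (nth 0 s 0 == 0) && (v == 0) ||
  has (fun a => nth 0 s 0 == 2 ^ a * (v + v).+1) (iota 0 (nth 0 s 0)))).
  by rec_auto.
move=> _ s v; rewrite -[nth 0 s 0]CodeSeq.decodeK; move: (decode _) => u.
rewrite CodeSeq.codeK; case: u => [|a u]; first by rewrite /= orbF.
rewrite code_cons /= muln_eq0 expn_eq0 /=; apply/hasP/eqP.
  by case=> m _ /eqP/pow2_odd_inj[].
move=> ->; exists a => //; rewrite mem_iota add0n /=.
by rewrite (leq_trans (ltn_expl a (isT : 1 < 2)))// leq_pmulr.
Qed.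

Lemma recf_nth k F G : recf k F -> recf k G ->
  recf k (fun p s => nth 0 (decode (F p s)) (G p s)).
Proof.
move=> recF recG.
apply: (@recf_ext _ (fun p s => head 0 (decode
  (iteri (G p s) (fun _ w => code (behead (decode w))) (F p s))))).
  move=> p s; rewrite -nth0 -[G p s in RHS]addn0 -nth_drop; congr nth.
  elim: (G p s) => [|n IHn]; first by rewrite drop0.
  by rewrite /= CodeSeq.codeK IHn -drop1 drop_drop.
by apply/recf_head/recf_iteri => //; apply: recf_behead; exact: recf_proj.
Qed.

(* The list is built from its last element, hence the reversed index. *)
Lemma recf_code_mkseq k f N : recf k N ->
  recf k.+1 (fun p s => f p (drop 1 s) (nth 0 s 0)) ->
  recf k (fun p s => code (mkseq (f p s) (N p s))).
Proof.
move=> recN recf_f.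
pose G p s i w := 2 ^ f p s (N p s - i.+1) * (w + w).+1.
apply: (@recf_ext _ (fun p s => iteri (N p s) (G p s) 0)).
  move=> p s; rewrite /G; set n := N p s; rewrite /mkseq.
  suff H m : m <= n -> iteri m (fun i w => 2 ^ f p s (n - i.+1) * (w + w).+1) 0 =
      code [seq f p s i | i <- iota (n - m) m] by rewrite H ?subnn.
  elim: m => // m IHm mn.
  rewrite (_ : iota (n - m.+1) m.+1 = n - m.+1 :: iota (n - m) m); last first.
    by rewrite /= -subSn// subSS.
  by rewrite [RHS]code_cons -IHm 1?ltnW.
apply: recf_iteri => //; first exact: recf_const.
apply: recf_mul; last by rec_auto.
apply: recf_exp2.
apply: (@recf_bind k 2 f (fun p s => N p (drop 2 s) - (nth 0 s 0).+1)) => //.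
apply: recf_sub; last by rec_auto.
exact: (recf_drop 2).
Qed.

Lemma recf_size k F : recf k F -> recf k (fun p s => size (decode (F p s))).
Proof.
move: k F; apply: (recf_comp1 (h := fun n => size (decode n))).
(* Reading [v] entries and coding them again gives back the number exactly if [v] is the length. *)
apply: (@recf_graph _ _ (fun _ s v =>
  code (mkseq (fun i => nth 0 (decode (nth 0 s 0)) i) v) == nth 0 s 0)).
  apply: recp_eq; last by rec_auto.
  by apply: recf_code_mkseq; [|apply: recf_nth]; rec_auto.
move=> _ s v; rewrite -[X in _ == X]CodeSeq.decodeK.
rewrite (can_eq CodeSeq.codeK); move: (decode _) => u; apply/eqP/eqP => [<-|->].
  by rewrite size_mkseq.
exact: mkseq_nth.
Qed.

Lemma recp_prefix k F G : recf k F -> recf k G ->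
  recp k (fun p s => prefix (decode (F p s)) (decode (G p s))).
Proof.
move=> recF recG.
apply: (@recf_ext _ (fun p s => (size (decode (F p s)) <= size (decode (G p s))) &&
  (code (mkseq (fun i => nth 0 (decode (G p s)) i) (size (decode (F p s)))) ==
   F p s))).
  move=> p s; rewrite -[X in _ == X]CodeSeq.decodeK (can_eq CodeSeq.codeK).
  rewrite prefixE; move: (decode (F p s)) (decode (G p s)) => u v; congr nat_of_bool.
  case: leqP => /= uv.
    congr (_ == _); rewrite -[take _ _](mkseq_nth 0) size_takel//.
    by apply/eq_in_map => i; rewrite mem_iota => /= iu; rewrite nth_take.
  apply/esym/negbTE/eqP => /(congr1 size).
  rewrite size_take_min /minn ltnNge (ltnW uv)/= => uvE.
  by move: uv; rewrite uvE ltnn.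
apply: recp_and; first by apply: recp_leq; exact: recf_size.
apply: recp_eq => //; apply: recf_code_mkseq; first exact: recf_size.
by apply: recf_nth; [exact: (recf_drop 1)|exact: recf_proj].
Qed.

Lemma recf_half k F : recf k F -> recf k (fun p s => (F p s)./2).
Proof.
move: k F; apply: (recf_comp1 (h := fun n => n./2)).
apply: (@recf_graph _ _ (fun _ s v =>
  (v + v == nth 0 s 0) || ((v + v).+1 == nth 0 s 0))); first by rec_auto.
by move=> _ s v; lia.
Qed.

Lemma recf_pair k F G :
  recf k F -> recf k G -> recf k (fun p s => Cantor.to_nat (F p s, G p s)).
Proof.
move: k F G; apply: (recf_comp2 (h := fun x y => Cantor.to_nat (x, y))).
(* [Cantor.to_nat (x, y)] unfolds to [y] plus the sum of 1, ..., [y + x]. *)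
apply: (@recf_ext _ (fun _ s => nth 0 s 1 +
  iteri (nth 0 s 1 + nth 0 s 0) (fun i m => i.+1 + m) 0)) => //.
by apply: recf_add; [|apply: recf_iteri]; rec_auto.
Qed.

(** * Perfect kernels in Baire space *)

Definition cone (s : seq nat) : set baire := [set x | mkseq x (size s) = s].

Lemma mkseq_eqP (x y : nat -> nat) n :
  mkseq x n = mkseq y n <-> forall i, i < n -> x i = y i.
Proof.
split=> [xy i ilt|xy]; first by rewrite -(nth_mkseq 0 x ilt) xy nth_mkseq.
by apply/eq_in_map => i; rewrite mem_iota => /xy.
Qed.

Lemma take_mkseq (x : nat -> nat) m n : m <= n -> take m (mkseq x n) = mkseq x m.
Proof. by move=> mn; rewrite /mkseq -map_take take_iota (minn_idPl mn). Qed.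

Lemma cone_mkseq (x : baire) n : cone (mkseq x n) x.
Proof. by rewrite /cone /= size_mkseq. Qed.

Lemma cone_sub s t : prefix s t -> cone t `<=` cone s.
Proof.
move=> st x; rewrite /cone /= => xt; move: st; rewrite -{1}xt => /prefix_mkseq.
by move=> <-.
Qed.

Lemma cone_prefix s t x : cone s x -> cone t x -> size s <= size t -> prefix s t.
Proof.
move=> <- <-; rewrite !size_mkseq => st.
by rewrite prefixE size_mkseq take_mkseq.
Qed.

Lemma cone_comparable s t x : cone s x -> cone t x -> prefix s t || prefix t s.
Proof.
move=> xs xt; case: (leqP (size s) (size t)) => st.
  by rewrite (cone_prefix xs xt).
by rewrite (cone_prefix xt xs) ?orbT// ltnW.
Qed.

Lemma chain_limit (u : nat -> seq nat) :
  (forall n, prefix (u n) (u n.+1)) -> (forall n, n <= size (u n)) ->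
  exists x, forall n, cone (u n) x.
Proof.
move=> uS su; have mono m n : m <= n -> prefix (u m) (u n).
  elim: n => [|n IHn]; first by rewrite leqn0 => /eqP->; exact: prefix_refl.
  rewrite leq_eqVlt => /predU1P[->|/IHn mn]; first exact: prefix_refl.
  exact: prefix_trans mn (uS _).
(* [u i.+1] is longer than [i], so entry [i] exists there and persists along the chain. *)
exists (fun i => nth 0 (u i.+1) i) => n.
rewrite /cone /= -[RHS](mkseq_nth 0); apply/mkseq_eqP => i iu.
have nthE a b : a <= b -> i < size (u a) -> nth 0 (u a) i = nth 0 (u b) i.
  by move=> /mono; rewrite prefixE => /eqP abE ia; rewrite -[in LHS]abE nth_take.
case: (leqP i.+1 n) => [le|lt]; first by rewrite (nthE _ _ le)// su.
by rewrite -(nthE n i.+1)// ltnW.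
Qed.

Lemma closed_baireP (A : set baire) :
  closed A <-> forall x, (forall n, exists2 y, A y & mkseq y n = mkseq x n) -> A x.
Proof.
split=> [cA x xA|H x xA]; last first.
  apply: H => n; have [|y [Ay yx]] := xA [set y : baire | mkseq y n = mkseq x n].
    by apply/nbhs_baireP; exists n.
  by exists y.
apply: cA => U /nbhs_baireP[n nU]; have [y Ay yx] := xA n.
by exists y; split=> //; exact: nU.
Qed.

Lemma closed_body T : closed (body T).
Proof.
by apply/closed_baireP => x xT n; have [y yT <-] := xT n; exact: yT.
Qed.

Definition dense_in_itself (A : set baire) := forall x n, A x ->
  exists y, [/\ A y, y <> x & mkseq y n = mkseq x n].

Lemma perfect_baireP (A : set baire) :
  perfect_set A <-> closed A /\ dense_in_itself A.
Proof.
split=> [[cA lA]|[cA dA]].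
  split=> // x n; rewrite -{1}lA => /(_ [set y : baire | mkseq y n = mkseq x n]).
  case; first by apply/nbhs_baireP; exists n.
  by move=> y [/eqP yx Ay yxn]; exists y.
split=> //; apply/seteqP; split=> [x xA|x Ax U /nbhs_baireP[n nU]]; last first.
  by have [y [Ay yx yxn]] := dA x n Ax; exists y; split=> //; [exact/eqP|exact: nU].
apply: ((closed_baireP A).1 cA) => n.
have [|y [_ Ay yx]] := xA [set y : baire | mkseq y n = mkseq x n]; last by exists y.
by apply/nbhs_baireP; exists n.
Qed.

(** * Cantor schemes *)

Lemma heap_rec (S : Type) (s0 : S) (L R : S -> S) : exists h : nat -> S,
  h 0 = s0 /\ forall k, h k.*2.+1 = L (h k) /\ h k.*2.+2 = R (h k).
Proof.
(* The parent of node [k'.+1] is [k'./2]. The argument [n] is fuel; every amount from [k] on gives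
   the same value. *)
pose fix F n k {struct n} := match n, k with
  | n'.+1, k'.+1 => (if odd k' then R else L) (F n' k'./2)
  | _, _ => s0 end.
have F_stable n m k : k <= n -> k <= m -> F n k = F m k.
  elim: n m k => [|n IHn] [|m] [|k]//= kn km.
  by rewrite (IHn m)//; lia.
exists (fun k => F k k); split=> // k; rewrite /= odd_double/= doubleK uphalf_double.
by split; [rewrite (F_stable _ k)|congr R; apply: (F_stable k.*2.+1 k)] => //; lia.
Qed.

Lemma heap_ind (P : nat -> Prop) : P 0 ->
  (forall k, P k -> P k.*2.+1 /\ P k.*2.+2) -> forall k, P k.
Proof.
move=> P0 PS k; elim/ltn_ind: k => -[//|k] IHk.
have [] := PS k./2; first by apply: IHk; lia.
have := odd_double_half k; case: (odd k) => /= [|]; rewrite ?add1n ?add0n => ->//.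
Qed.

(* [f] is indexed as a binary heap: the children of node [k] are the nodes [2k+1]
   and [2k+2]. *)
Definition scheme (p : baire) (c : nat) (f : nat -> nat) : Prop :=
  prefix (decode c) (decode (f 0)) /\
  forall k, [/\ p (f k) = 1,
    prefix (decode (f k)) (decode (f k.*2.+1)),
    prefix (decode (f k)) (decode (f k.*2.+2)) &
    ~~ (prefix (decode (f k.*2.+1)) (decode (f k.*2.+2)) ||
        prefix (decode (f k.*2.+2)) (decode (f k.*2.+1)))].

Lemma charfunE p T : is_charfun p T -> forall n, (p n = 1) <-> T (decode n).
Proof.
move=> pT n; have := pT (decode n); rewrite CodeSeq.decodeK => ->.
by case: asboolP.
Qed.

Lemma proper_prefix_size (s t u : seq nat) :
  prefix s t -> prefix s u -> ~~ (prefix t u || prefix u t) -> size s < size t.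
Proof.
move=> st su; apply: contraR; rewrite -leqNgt => ts.
have tE : t = s by move: st; rewrite prefixE => /eqP; rewrite take_oversize.
by rewrite tE su.
Qed.

(** Cantor's diagonal argument: at level [n] the path goes right iff the left cone contains the
    point numbered [n] by [h]. The limit [x] of the path then has no number: at level [h x], turning
    right puts [x] into two disjoint cones, and turning left contradicts the choice. *)
Lemma scheme_uncountable p T c f : is_tree T -> is_charfun p T ->
  scheme p c f -> ~ countable (body T `&` cone (decode c)).
Proof.
move=> [_ treeT] pT [cf0 fP] /countable_injP[h hinj].
pose B := body T `&` cone (decode c).
pose left n k := exists y, [/\ B y, h y = n & cone (decode (f k.*2.+1)) y].
pose fix path n := if n is n'.+1 then
  if `[< left n' (path n') >] then (path n').*2.+2 else (path n').*2.+1 else 0.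
pose u n := decode (f (path n)).
have uS n : prefix (u n) (u n.+1) /\ size (u n) < size (u n.+1).
  have [_ p1 p2 p3] := fP (path n); rewrite /u /=; case: asboolP => _.
    by split=> //; apply: proper_prefix_size p2 p1 _; rewrite orbC.
  by split=> //; apply: proper_prefix_size p1 p2 _.
have su n : n <= size (u n).
  by elim: n => // n IHn; apply: leq_ltn_trans IHn _; have [] := uS n.
have [x xu] := chain_limit (fun n => (uS n).1) su.
have Bx : B x.
  split; last exact: cone_sub cf0 _ (xu 0).
  move=> n; apply: (treeT _ (u n)); last first.
    by apply/(charfunE pT); have [] := fP (path n).
  by rewrite -(xu n) prefixE size_mkseq take_mkseq.
have := xu (h x).+1; rewrite /u /=; case: asboolP => [[y [By hyx yl]]|nl] xr.
  have yx : y = x by apply: hinj => //; rewrite inE.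
  have [_ _ _ /negP] := fP (path (h x)); apply.
  by rewrite yx in yl; exact: cone_comparable yl xr.
by apply: nl; exists x.
Qed.

(** A node carries a point of [Q] and a length. The left child keeps the point and the right child
    moves to a nearby one; both get a length at which the two points differ. *)
Lemma scheme_of_dense p T c (Q : set baire) x : is_charfun p T ->
  dense_in_itself Q -> Q `<=` body T -> Q x -> cone (decode c) x ->
  exists f, scheme p c f.
Proof.
move=> pT dQ QT Qx xc.
have /choice[next nextP] : forall s : baire * nat, exists t : baire * nat, Q s.1 ->
    [/\ Q t.1, s.2 <= t.2, mkseq t.1 s.2 = mkseq s.1 s.2 &
        mkseq t.1 t.2 <> mkseq s.1 t.2].
  case=> y l.
  have [Qy|nQy] := pselect (Q y); last by exists (y, l).
  have [z [Qz zy zyl]] := dQ y l Qy.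
  have [i zyi] : exists i, z i <> y i.
    by apply: contrapT => /forallNP zyE; apply: zy; apply/funext => i; exact: contrapT.
  exists (z, maxn l i.+1); split=> //=; first exact: leq_maxl.
  by move/mkseq_eqP => /(_ i); rewrite leq_maxr => /(_ isT).
have [h [h0 hS]] := heap_rec (x, size (decode c))
  (fun s => (s.1, (next s).2)) next.
have Qh k : Q (h k).1.
  elim/heap_ind: k => [|k Qk]; first by rewrite h0.
  by have [-> ->] := hS k; split=> //; have [] := nextP _ Qk.
exists (fun k => code (mkseq (h k).1 (h k).2)); split.
  by rewrite CodeSeq.codeK h0 /= xc prefix_refl.
move=> k; rewrite !CodeSeq.codeK; have [-> ->] := hS k.
have [Qn le eqn neqn] := nextP _ (Qh k).
split.
- by apply/(charfunE pT); rewrite CodeSeq.codeK; exact: QT.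
- by rewrite prefixE size_mkseq take_mkseq.
- by rewrite prefixE size_mkseq take_mkseq// eqn.
- rewrite !prefixE /= !size_mkseq !take_oversize ?size_mkseq// eq_sym orbb.
  exact/eqP/nesym.
Qed.

(** If the cone missed [P], the branches of [T] in it would lie in a countable set, which a scheme
    forbids. This turns meeting the kernel into an existential statement about [p]. *)
Lemma perfect_kernel_meets_cone p T (P : set baire) c : is_tree T -> is_charfun p T ->
  is_perfect_kernel (body T) P ->
  (P `&` cone (decode c) !=set0) <-> exists f, scheme p c f.
Proof.
move=> treeT pT [/perfect_baireP[_ dP] PT cP]; split=> [[x [Px xc]]|[f fs]].
  exact: scheme_of_dense pT dP PT Px xc.
apply: contrapT => /nonemptyPn PcE; apply: (scheme_uncountable treeT pT fs).
apply: sub_countable cP; apply: subset_card_le => x [xT xc]; split=> // Px.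
by have : (P `&` cone (decode c)) x by []; rewrite PcE.
Qed.

(** Both kernels meet the same cones, namely those carrying a scheme, and a closed set is determined
    by the cones it meets. *)
Lemma perfect_kernel_unique p T (P Q : set baire) : is_tree T -> is_charfun p T ->
  is_perfect_kernel (body T) P -> is_perfect_kernel (body T) Q -> P = Q.
Proof.
move=> treeT pT; suff sub P' Q' : is_perfect_kernel (body T) P' ->
    is_perfect_kernel (body T) Q' -> P' `<=` Q'.
  by move=> kP kQ; apply/seteqP; split; exact: sub.
move=> kP kQ x Px; have [/perfect_baireP[/closed_baireP clQ _] _ _] := kQ.
apply: clQ => n; have xc : cone (decode (code (mkseq x n))) x.
  by rewrite CodeSeq.codeK; exact: cone_mkseq.
have : P' `&` cone (decode (code (mkseq x n))) !=set0 by exists x.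
move/(perfect_kernel_meets_cone _ treeT pT kP)/(perfect_kernel_meets_cone _ treeT pT kQ).
case=> y [Qy]; rewrite CodeSeq.codeK /cone /= size_mkseq => yx.
by exists y.
Qed.

(** * Fans of trees *)

(** This is the decomposition [c 0^n a y] with [a > 0]: [a] stands at position [n.+1] and [y] starts
    at [n.+2]. *)
Definition leads (z : nat -> nat) (n : nat) : bool :=
  (0 < z n.+1) && all (fun i => z i.+1 == 0) (iota 0 n).

(** Only the first [N] entries of [z] are inspected, so strings and points are treated alike; [m]
    runs over the lengths of the prefixes of [y] that fit. *)
Definition fan_check (W : nat -> seq nat -> bool) (z : nat -> nat) (N : nat) : bool :=
  all (fun n => leads z n ==>
    all (fun m => W (z 0) (mkseq (fun i => (z (n.+2 + i))./2) m))
      (iota 0 (N - n.+1))) (iota 0 N.-1).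

(* The branches are [c 0^w] and the [c 0^n a y] with [a > 0] such that halving
   every entry of [y] gives a branch of [W c]. The parities of [y] are free, so
   that no branch of the second kind is isolated. *)
Definition fan (W : nat -> seq nat -> bool) : set (seq nat) :=
  [set t | fan_check W (nth 0 t) (size t)].

Definition branches (W : nat -> seq nat -> bool) (c : nat) : set baire :=
  [set f | forall m, W c (mkseq f m)].

Definition spine (c : nat) : baire := fun i => if i is 0 then c else 0.

Implicit Types W : nat -> seq nat -> bool.

Lemma leadsP z n : reflect (0 < z n.+1 /\ forall i, i < n -> z i.+1 = 0) (leads z n).
Proof.
apply: (iffP andP) => -[zn zi]; split=> //.
  by move=> i iltn; apply/eqP; move/allP: zi; apply; rewrite mem_iota.
by apply/allP => i; rewrite mem_iota => /zi ->.
Qed.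

Lemma leads_unique z m n : leads z m -> leads z n -> m = n.
Proof.
move=> /leadsP[zm zm0] /leadsP[zn zn0]; case: (ltngtP m n) => // [/zn0|/zm0] E.
  by rewrite E in zm.
by rewrite E in zn.
Qed.

Lemma fan_checkP W z N : reflect (forall n m, leads z n -> n.+1 + m < N ->
  W (z 0) (mkseq (fun i => (z (n.+2 + i))./2) m)) (fan_check W z N).
Proof.
apply: (iffP allP) => H n => [m lead nm|].
  have nN : n \in iota 0 N.-1 by rewrite mem_iota; lia.
  by have /implyP/(_ lead)/allP := H n nN; apply; rewrite mem_iota; lia.
move=> _; apply/implyP => lead; apply/allP => m; rewrite mem_iota => mN.
by apply: H => //; lia.
Qed.

Lemma fan_check_prefix W z z' M N : M <= N -> (forall i, i < M -> z i = z' i) ->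
  fan_check W z N -> fan_check W z' M.
Proof.
move=> MN zz' /fan_checkP H; apply/fan_checkP => n m /leadsP[zn zi] nm.
have leadz : leads z n.
  apply/leadsP; split; first by rewrite zz'//; lia.
  by move=> i ilt; rewrite zz' ?zi//; lia.
rewrite -zz'; last by lia.
rewrite (_ : mkseq _ m = mkseq (fun i => (z (n.+2 + i))./2) m).
  by apply: H => //; lia.
by apply/mkseq_eqP => i im; rewrite zz'//; lia.
Qed.

Lemma is_tree_fan W : is_tree (fan W).
Proof.
split; first by exists [::].
move=> s t st; rewrite /fan /= => tW; apply: fan_check_prefix tW.
  exact: size_prefix.
by move=> i ilt; move: st; rewrite prefixE => /eqP E; rewrite -[in RHS]E nth_take.
Qed.

Lemma body_fanP W (x : baire) : body (fan W) x <->
  forall n, leads x n -> branches W (x 0) (fun i => (x (n.+2 + i))./2).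
Proof.
split=> [xW n lead m|xW N].
  have check N : fan_check W x N.
    have : fan_check W (nth 0 (mkseq x N)) (size (mkseq x N)) := xW N.
    by rewrite size_mkseq; apply: fan_check_prefix => // i iN; rewrite nth_mkseq.
  by move/fan_checkP: (check (n.+2 + m)); apply => //; lia.
suff : fan_check W (nth 0 (mkseq x N)) (size (mkseq x N)) by [].
rewrite size_mkseq.
have : fan_check W x N by apply/fan_checkP => n m /xW + _; apply.
by apply: fan_check_prefix => // i iN; rewrite nth_mkseq.
Qed.

Lemma spine_or_leads (x : baire) : x = spine (x 0) \/ exists n, leads x n.
Proof.
have [/existsNP[n0 xn0]|/contrapT x0] := pselect (~ forall n, x n.+1 = 0).
  have ex : exists n, 0 < x n.+1 by exists n0; lia.
  right; exists (ex_minn ex); case: ex_minnP => n xn nmin; apply/leadsP; split=> //.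
  by move=> i iltn; have := nmin i; case: (x i.+1) => // k /(_ isT); lia.
by left; apply/funext => -[|n] //=; rewrite x0.
Qed.

Lemma spineNleads c n : ~~ leads (spine c) n.
Proof. by []. Qed.

Definition fan_kernel W : set baire :=
  [set x | body (fan W) x /\ branches W (x 0) !=set0].

(** A branch off the spines carries a branch of the tree at its first entry, so only spines can lie
    outside the kernel. *)
Lemma fan_setD_kernel W : body (fan W) `\` fan_kernel W =
  [set spine c | c in [set c | branches W c = set0]].
Proof.
apply/seteqP; split=> [x [xW nx]|_ [c Wc <-]].
  have Wx : branches W (x 0) = set0.
    by apply/nonemptyPn => Wx; exact: nx.
  exists (x 0) => //; case: (spine_or_leads x) => // -[n lead].
  have /body_fanP/(_ n lead) := xW; by rewrite Wx.
split; first by apply/body_fanP => n; rewrite (negbTE (spineNleads _ _)).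
by case=> _ [y]; rewrite /= Wc.
Qed.

Lemma perfect_kernel_fan W : is_perfect_kernel (body (fan W)) (fan_kernel W).
Proof.
split; last 2 first.
- by move=> x [].
- by rewrite fan_setD_kernel; apply: sub_countable (card_image_le _ _) _.
apply/perfect_baireP; split.
  apply/closed_baireP => x xP; split.
    apply: (closed_baireP _).1 (@closed_body (fan W)) _ _ => n.
    by have [y [yW _] yx] := xP n; exists y.
  by have [y [_ yW] [<-]] := xP 1.
move=> x n [xW [f fW]]; case: (spine_or_leads x) => [xE|[k lead]].
  (* Leave the spine at position [n.+1] by the entry 1 and continue with the doubled [f], whose
     halves are [f] again. *)
  pose y : baire := fun i => if i <= n then x i else
    if i == n.+1 then 1 else (f (i - n.+2)).*2.
  have yleads : leads y n.
    apply/leadsP; rewrite /y ltnn eqxx; split=> // i iltn.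
    by rewrite iltn xE.
  have y0 : y 0 = x 0 by [].
  exists y; split.
  - split; last by exists f; rewrite y0.
    apply/body_fanP => m leadm; rewrite -(leads_unique yleads leadm) y0.
    rewrite (_ : (fun i => _) = f)//; apply/funext => i; rewrite /y.
    by rewrite ifF ?ifF ?addKn ?doubleK//; lia.
  - by move=> yx; have := spineNleads (x 0) n; rewrite -xE -yx yleads.
  - by apply/mkseq_eqP => i iltn; rewrite /y ltnW.
(* Flip the parity of one entry: from [n] on to keep the prefix, and from [k.+2] on, where only the
   halves are constrained. *)
pose N := maxn n k.+2.
pose y : baire := fun i => if i == N then (x i)./2.*2 + ~~ odd (x i) else x i.
have yhalf i : (y i)./2 = (x i)./2 by rewrite /y; case: eqP => // _; lia.
have yE i : i < N -> y i = x i by rewrite /y => /ltn_eqF ->.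
have y0 : y 0 = x 0 by apply: yE; rewrite /N; lia.
have yleads : leads y k.
  case/leadsP: lead => xk xi; apply/leadsP; split; first by rewrite yE// /N; lia.
  by move=> i ik; rewrite yE ?xi// /N; lia.
exists y; split.
- split; last by exists f; rewrite y0.
  apply/body_fanP => m leadm; rewrite -(leads_unique yleads leadm) y0.
  rewrite (_ : (fun i => _) = (fun i => (x (k.+2 + i))./2)).
    exact: (body_fanP W x).1.
  by apply/funext => i; rewrite yhalf.
- by move=> /(congr1 (fun z : baire => z N)); rewrite /y eqxx; lia.
- by apply/mkseq_eqP => i iltn; rewrite yE// /N; lia.
Qed.

Definition fan_name W : baire :=
  fun n => nat_of_bool (fan_check W (nth 0 (decode n)) (size (decode n))).

Definition fan_closed W : closed_set := exist _ _ (@closed_body (fan W)).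

Lemma is_charfun_fan W : is_charfun (fan_name W) (fan W).
Proof. by move=> t; rewrite /fan_name CodeSeq.codeK /fan /= asboolb. Qed.

Lemma tree_name_fan W : tree_name (fan_name W) (fan_closed W).
Proof. by exists (fan W); split; [exact: is_tree_fan|exact: is_charfun_fan|]. Qed.

Lemma dom_ScList_fan W : dom ScList (fan_closed W).
Proof.
have [/perfect_baireP[clP _] _ _] := perfect_kernel_fan W.
pose P : closed_set := exist _ _ clP.
pose D := body (fan W) `\` fan_kernel W.
have [n nP] : exists n, (infinite_set D /\ n = 0) \/
    exists2 k, (D #= `I_k)%card & n = k.+1.
  have [[k Dk]|Dinf] := pselect (finite_set D); last by exists 0; left.
  by exists k.+1; right; exists k.
exists (n, fun i => (`[< branches W i = set0 >], spine i)), P.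
  exact: perfect_kernel_fan.
split=> //=; rewrite fan_setD_kernel; apply/seteqP; split=> x /=.
  by case=> c Wc <-; exists c; split=> //; apply/asboolP.
by case=> c [/asboolP Wc <-]; exists c.
Qed.

(** By uniqueness of the kernel, a solution lists exactly the spines of the well-founded [W c], and
    [c] is read off as the first entry. The first equivalence serves the reduction, the second the
    failure of its converse. *)
Lemma ScList_fanP W v : ScList (fan_closed W) v ->
  (forall c, branches W c = set0 <-> exists i, (v.2 i).1 = true /\ (v.2 i).2 0 = c) /\
  (v.1 = 1 <-> forall c, branches W c !=set0).
Proof.
case=> P PK_P /=.
rewrite -(perfect_kernel_unique (is_tree_fan W) (@is_charfun_fan W)
  (perfect_kernel_fan W) PK_P) fan_setD_kernel => -[DE count]; split.
  move=> c; split=> [Wc|[i [bi <-]]].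
    have : [set spine c | c in [set c | branches W c = set0]] (spine c) by exists c.
    by rewrite DE => -[i [bi xi]]; exists i; rewrite xi.
  have : [set x | exists i, (v.2 i).1 = true /\ (v.2 i).2 = x] (v.2 i).2 by exists i.
  by rewrite -DE => -[d Wd <-].
have D0 : [set spine c | c in [set c | branches W c = set0]] = set0 <->
    forall c, branches W c !=set0.
  split=> [E c|Wn]; last first.
    apply/seteqP; split=> // x [c Wc _]; have [y] := Wn c.
    by rewrite (Wc : branches W c = set0).
  apply: contrapT => /nonemptyPn Wc.
  by have : set0 (spine c) by rewrite -E; exists c.
rewrite -D0; split=> [v1|E].
  case: count => [[_ v0]|[k Dk vk]]; first by rewrite v1 in v0.
  have k0 : k = 0 by have := vk; rewrite v1 => -[].
  by move: Dk; rewrite k0 II0 card_eq0 => /eqP.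
case: count => [[]|[k Dk ->]]; first by rewrite E => /(_ (finite_set0 _)).
have : (`I_k #= @set0 baire)%card by rewrite card_eq_sym -E.
rewrite card_eq0 => /eqP Ik; case: k Ik {Dk} => // k Ik.
by have : `I_k.+1 0 by []; rewrite Ik.
Qed.

(** * Reduction of [PK] to [ScList] *)

Lemma recf_double k F : recf k F -> recf k (fun p s => (F p s).*2).
Proof.
move=> recF; apply: (@recf_ext _ (fun p s => F p s + F p s)); last exact: recf_add.
by move=> p s; rewrite addnn.
Qed.

Ltac rec_solve := repeat first
  [ apply: recf_nth | apply: recf_size | apply: recf_half | apply: recf_double
  | apply: recf_pair | apply: recp_prefix
  | rec_step ].

(** A node is compared with its children only once both are present. The root condition stands
    inside the quantifier so that the empty string, which has no root yet, passes. *)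
Definition scheme_check (p : baire) (c : nat) (t : seq nat) : bool :=
  all (fun k => [&& p (nth 0 t k) == 1,
    prefix (decode c) (decode (nth 0 t 0)) &
    (k.*2.+2 < size t) ==> [&&
      prefix (decode (nth 0 t k)) (decode (nth 0 t k.*2.+1)),
      prefix (decode (nth 0 t k)) (decode (nth 0 t k.*2.+2)) &
      ~~ (prefix (decode (nth 0 t k.*2.+1)) (decode (nth 0 t k.*2.+2)) ||
          prefix (decode (nth 0 t k.*2.+2)) (decode (nth 0 t k.*2.+1)))]])
  (iota 0 (size t)).

Lemma branches_scheme_check p c f : branches (scheme_check p) c f <-> scheme p c f.
Proof.
split=> [fW|[cf0 fP] m].
  have check k : [&& p (f k) == 1, prefix (decode c) (decode (f 0)) &
      [&& prefix (decode (f k)) (decode (f k.*2.+1)),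
          prefix (decode (f k)) (decode (f k.*2.+2)) &
          ~~ (prefix (decode (f k.*2.+1)) (decode (f k.*2.+2)) ||
              prefix (decode (f k.*2.+2)) (decode (f k.*2.+1)))]].
    have kin : k \in iota 0 (size (mkseq f k.*2.+3)).
      by rewrite size_mkseq mem_iota; lia.
    have /allP/(_ k kin) := fW k.*2.+3.
    have nthE i : i <= k.*2.+2 -> nth 0 (mkseq f k.*2.+3) i = f i.
      by move=> ik; rewrite nth_mkseq.
    by rewrite size_mkseq ltnSn !nthE//; lia.
  split; first by have /and3P[] := check 0.
  by move=> k; have /and3P[/eqP pk _ /and3P[]] := check k.
apply/allP => k; rewrite size_mkseq mem_iota => km.
have [pk k1 k2 k12] := fP k.
have nthE i : i < m -> nth 0 (mkseq f m) i = f i by exact: nth_mkseq.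
rewrite (nthE k) ?(nthE 0) ?pk ?cf0 ?eqxx /=; [|lia..].
by apply/implyP => lt; rewrite !nthE ?k1 ?k2//; lia.
Qed.

Lemma recp_scheme_check k C M : recf k C -> recf k M ->
  recp k (fun p s => scheme_check p (C p s) (decode (M p s))).
Proof.
move=> recC recM.
apply: (@recf_comp k (fun p s =>
  nat_of_bool (scheme_check p (nth 0 s 0) (decode (nth 0 s 1)))) [:: C; M]) => //.
by rewrite -/(recp _ _); rec_solve.
Qed.

Lemma recf_fan_name : recf 1 (fun p s => fan_name (scheme_check p) (nth 0 s 0)).
Proof.
(* The string is routed through its code, since programs pass on numbers only. *)
pose W p c t := scheme_check p c (decode (code t)).
apply: (@recf_ext _ (fun p s => fan_name (W p) (nth 0 s 0))).
  move=> p s; congr fan_name; apply/funext => c; apply/funext => t.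
  by rewrite /W CodeSeq.codeK.
rewrite /fan_name -/(recp _ _) /fan_check /leads /W.
repeat first [apply: recp_scheme_check | apply: recf_code_mkseq | progress rec_solve].
Qed.

(* The strings accepted by the tree named by [evens r], minus the extensions of
   the strings [sigma] such that [sigma 0^w] is listed by [odds r]. *)
Definition kernel_name (r : baire) : baire := fun n =>
  nat_of_bool ((r n.*2 == 1) &&
    all (fun i => (r (Cantor.to_nat (i, 0)).*2.+1.*2.+1 == 1) ==>
      ~~ prefix (decode (r (Cantor.to_nat (i, 1)).*2.+1.*2.+1)) (decode n))
    (iota 0 (size (decode n)))).

Lemma recf_kernel_name : recf 1 (fun p s => kernel_name p (nth 0 s 0)).
Proof. rewrite -/(recp _ _). rec_solve. Qed.

Lemma computable_total (F : baire -> baire) :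
  recf 1 (fun p s => F p (nth 0 s 0)) -> computable_map (fun p => Some (F p)).
Proof. by case=> c cP; exists c => p q [<-] n; exact: (cP p [:: n]). Qed.

Lemma PK_le_ScList : PK <=_W ScList.
Proof.
exists (fun p => Some (fan_name (scheme_check p))), (fun r => Some (kernel_name r)).
split; [exact/computable_total/recf_fan_name|exact/computable_total/recf_kernel_name|].
move=> p A [T [treeT pT TA]] [P PKP].
exists (fan_name (scheme_check p)), (fan_closed (scheme_check p)); split=> //.
- exact: tree_name_fan.
- exact: dom_ScList_fan.
move=> q v qv /ScList_fanP[listE _].
exists (kernel_name (interleave p q)), P; split=> //.
move: PKP; rewrite /PK /= -TA => kerP.
have [/perfect_baireP[/closed_baireP clP _] PT _] := kerP.
have avoidE c : (exists i, (v.2 i).1 = true /\ (v.2 i).2 0 = c) <->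
    ~ (sval P `&` cone (decode c) !=set0).
  rewrite -listE (perfect_kernel_meets_cone _ treeT pT kerP); split=> [E [f]|nf].
    by move/branches_scheme_check; rewrite E.
  by apply/seteqP; split=> // f /branches_scheme_check fs; apply: nf; exists f.
have /= [_ qseq] := qv.
(* The outer [.*2.+1] selects [q] in the interleaving, the inner one the list in the name [q]. In
   row [i], position 0 holds the bit and position 1 the first entry of the listed point. *)
have bitE i : interleave p q (Cantor.to_nat (i, 0)).*2.+1.*2.+1 = (v.2 i).1.
  have [<- _] := qseq i; rewrite -[LHS]/(odds (interleave p q) _).
  by rewrite interleaveK2.
have headE i : interleave p q (Cantor.to_nat (i, 1)).*2.+1.*2.+1 = (v.2 i).2 0.
  have [_ <-] := qseq i; rewrite -[LHS]/(odds (interleave p q) _).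
  by rewrite interleaveK2.
pose S : set (seq nat) := [set t | T t /\ forall i, i < size t -> (v.2 i).1 = true ->
  ~~ prefix (decode ((v.2 i).2 0)) t].
exists S; split.
- split.
    exists [::]; split=> //; case: treeT => -[t Tt] treeT.
    by apply: treeT Tt; exact: prefix0s.
  move=> s t st [Tt tS]; split; first exact: treeT.2 st Tt.
  move=> i ilt bi; have := tS i (leq_trans ilt (size_prefix st)) bi.
  by apply: contra => /prefix_trans; exact.
- move=> t; rewrite /kernel_name CodeSeq.codeK; congr nat_of_bool.
  rewrite -[interleave p q _]/(evens (interleave p q) _) interleaveK1 pT.
  apply/idP/asboolP => [/andP[Tt /allP tS]|[Tt tS]].
    split; first by move: Tt; case: asboolP.
    move=> i ilt bi; have := tS i; rewrite mem_iota bitE headE bi; exact.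
  rewrite asboolT//=; apply/allP => i; rewrite mem_iota => ilt.
  rewrite bitE headE; apply/implyP => bi; apply: tS => //.
  by case: ((v.2 i).1) bi.
- apply/seteqP; split=> [x xS|x Px n].
    apply: clP => n; have := avoidE (code (mkseq x n)); rewrite CodeSeq.codeK => avoid.
    have : sval P `&` cone (mkseq x n) !=set0.
      (* A cone missing the kernel is listed at some [i], and prefixes of [x] longer than [i] are
         tested against that entry. *)
      apply: contrapT => /avoid[i [bi xi]].
      have [_ /(_ i)] := xS (maxn n i.+1); rewrite size_mkseq leq_maxr.
      move=> /(_ isT bi); rewrite xi CodeSeq.codeK prefixE size_mkseq.
      by rewrite take_mkseq ?leq_maxl// eqxx.
    by case=> y [Py]; rewrite /cone /= size_mkseq; exists y.
  split; first exact: PT.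
  move=> i _ bi; apply/negP => pre; apply: (avoidE ((v.2 i).2 0)).1; first by exists i.
  exists x; split=> //; apply: cone_sub pre _ _; exact: cone_mkseq.
Qed.

(** * Failure of the converse reduction *)

(** The arguments of [Comp] form a list of codes, so the hypothesis must range over its members. *)
Lemma code_nested_ind (P : Defs.code -> Prop) :
  P Zero -> P Succ -> (forall i, P (Proj i)) -> P Oracle ->
  (forall c cs, P c -> foldr (fun d Q => P d /\ Q) True cs -> P (Comp c cs)) ->
  (forall c d, P c -> P d -> P (PrimRec c d)) ->
  (forall c, P c -> P (Mu c)) -> forall c, P c.
Proof.
move=> P0 PS Pp Po PC PR PM; fix IH 1 => -[||i||c cs|c d|c].
- exact: P0.
- exact: PS.
- exact: Pp.
- exact: Po.
- by apply: PC => //; elim: cs => [|d cs IHcs]; split.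
- exact: PR.
- exact: PM.
Qed.

Lemma eval_functional p c s v w : eval p c s v -> eval p c s w -> v = w.
Proof.
elim/code_nested_ind: c s v w => /=.
- by move=> s v w -> ->.
- by move=> s v w -> ->.
- by move=> i s v w -> ->.
- by move=> s v w -> ->.
- move=> c cs IHc IHcs s v w [us [cus cv]] [us' [cus' cw]].
  suff E : us = us' by rewrite -E in cw; exact: IHc cv cw.
  elim: cs us us' IHcs cus cus' {cv cw} => [|d cs IH] [|u us] [|u' us'] //=.
  by move=> [Pd Pcs] [du cus] [du' cus']; congr (_ :: _); [exact: Pd du du'|exact: IH].
- move=> c d IHc IHd [//|n s] v w; elim: n v w => [|n IHn] v w /=; first exact: IHc.
  by move=> [a [na av]] [b [nb bw]]; rewrite (IHn _ _ na nb) in av; exact: IHd av bw.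
- move=> c IHc s v w [cv vmin] [cw wmin]; case: (ltngtP v w) => // lt.
    by have [u cu] := wmin _ lt; have := IHc _ _ _ cv cu.
  by have [u cu] := vmin _ lt; have := IHc _ _ _ cw cu.
Qed.

(** A halting computation queries the oracle only finitely often. *)
Lemma eval_continuous p c s v : eval p c s v ->
  exists N, forall p', mkseq p' N = mkseq p N -> eval p' c s v.
Proof.
elim/code_nested_ind: c s v => /=.
- by move=> s v vE; exists 0.
- by move=> s v vE; exists 0.
- by move=> i s v vE; exists 0.
- by move=> s v ->; exists (nth 0 s 0).+1 => p' /mkseq_eqP ->.
- move=> c cs IHc IHcs s v [us [cus /IHc[N NP]]].
  have [M MP] : exists M, forall p', mkseq p' M = mkseq p M ->
      pointwise (fun g w => eval p' g s w) cs us.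
    elim: cs us IHcs cus {NP} => [|d cs IH] [|u us] //=; first by exists 0.
    move=> [Pd Pcs] [/Pd[M1 M1P] /(IH _ Pcs)[M2 M2P]].
    exists (maxn M1 M2) => p' /mkseq_eqP E; split.
      by apply/M1P/mkseq_eqP => i iM; rewrite E// leq_max iM.
    by apply/M2P/mkseq_eqP => i iM; rewrite E// leq_max iM orbT.
  exists (maxn M N) => p' /mkseq_eqP E; exists us; split.
    by apply/MP/mkseq_eqP => i iM; rewrite E// leq_max iM.
  by apply/NP/mkseq_eqP => i iM; rewrite E// leq_max iM orbT.
- move=> c d IHc IHd [//|n s] v; elim: n v => [|n IHn] v /=; first exact: IHc.
  move=> [w [/IHn[M MP] /IHd[N NP]]].
  exists (maxn M N) => p' /mkseq_eqP E; exists w; split.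
    by apply/MP/mkseq_eqP => i iM; rewrite E// leq_max iM.
  by apply/NP/mkseq_eqP => i iM; rewrite E// leq_max iM orbT.
- move=> c IHc s v [/IHc[N NP] vmin].
  have [M MP] : exists M, forall p', mkseq p' M = mkseq p M ->
      forall m, m < v -> exists w, eval p' c (m :: s) w.+1.
    elim: v vmin {NP} => [|v IHv] vmin; first by exists 0.
    have [|M1 M1P] := IHv; first by move=> m mv; apply: vmin; exact: ltnW.
    have [w /IHc[M2 M2P]] := vmin v (ltnSn v).
    exists (maxn M1 M2) => p' /mkseq_eqP E m; rewrite ltnS leq_eqVlt => /predU1P[->|].
      by exists w; apply/M2P/mkseq_eqP => i iM; rewrite E// leq_max iM orbT.
    by apply: M1P; apply/mkseq_eqP => i iM; rewrite E// leq_max iM.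
  exists (maxn M N) => p' /mkseq_eqP E; split.
    by apply/NP/mkseq_eqP => i iM; rewrite E// leq_max iM orbT.
  by apply/MP/mkseq_eqP => i iM; rewrite E// leq_max iM.
Qed.

Lemma recf_continuous k F p s : recf k F -> size s = k ->
  exists N, forall p', mkseq p' N = mkseq p N -> F p' s = F p s.
Proof.
move=> [c cP] sk; have [N NP] := eval_continuous (cP p s sk).
by exists N => p' /NP; exact: eval_functional (cP p' s sk).
Qed.

Lemma continuous_upto (G : baire -> baire) (x : baire) :
  (forall n, exists N, forall x', mkseq x' N = mkseq x N -> G x' n = G x n) ->
  forall n, exists N, forall x', mkseq x' N = mkseq x N ->
    mkseq (G x') n = mkseq (G x) n.
Proof.
move=> Gx; elim=> [|n [M MP]]; first by exists 0.
have [N NP] := Gx n; exists (maxn M N) => x' /mkseq_eqP E; rewrite !mkseqS.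
congr rcons; first by apply/MP/mkseq_eqP => i iM; rewrite E// leq_max iM.
by apply/NP/mkseq_eqP => i iM; rewrite E// leq_max iM orbT.
Qed.

(** The answer is the same for all [c], so the scattered part of the fan is either empty or consists
    of all spines. *)
Definition diag_check (x : baire) (c : nat) (t : seq nat) : bool :=
  x (Cantor.to_nat (code (mkseq x (size t)), code t)) == 1.

(* Every closed set [K] of pairs is coded by a point, and [diag_check x] accepts
   the branches of the section at [x] of the closed set coded by [x]. *)
Lemma diagonal (K : baire -> baire -> Prop) :
  (forall x f, (forall n, exists x' f', [/\ K x' f', mkseq x' n = mkseq x n &
     mkseq f' n = mkseq f n]) -> K x f) ->
  exists x, forall c f, branches (diag_check x) c f <-> K x f.
Proof.
move=> clK.
(* The pairs of equally long prefixes of a point of [K]; as [K] is closed, they determine it. *)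
pose B a b := exists x f n, [/\ K x f, mkseq x n = decode a & mkseq f n = decode b].
exists (fun n => nat_of_bool `[< B (Cantor.of_nat n).1 (Cantor.of_nat n).2 >]) => c f.
set x : baire := (fun n => _ : nat).
have xE a b : x (Cantor.to_nat (a, b)) = nat_of_bool `[< B a b >].
  by rewrite /x Cantor.cancel_of_to.
rewrite /branches /diag_check /=; split=> [fx|Kxf m].
  apply: clK => n; have := fx n; rewrite size_mkseq xE eqb1.
  move/asboolP => -[x' [f' [m [Kxf']]]]; rewrite !CodeSeq.codeK => x'E fE.
  have mn : m = n by rewrite -(size_mkseq x' m) x'E size_mkseq.
  by exists x', f'; rewrite -mn in x'E fE *.
rewrite size_mkseq xE eqb1; apply/asboolP.
by exists x, f, m; rewrite !CodeSeq.codeK.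
Qed.

Lemma recf_diag_name : recf 1 (fun p s => fan_name (diag_check p) (nth 0 s 0)).
Proof.
rewrite -/(recp _ _) /fan_name /fan_check /leads /diag_check.
apply: (@recf_ext _ (fun p s => all (fun n => (0 < nth 0 (decode (nth 0 s 0)) n.+1) &&
   all (fun i => nth 0 (decode (nth 0 s 0)) i.+1 == 0) (iota 0 n) ==>
   all (fun m => p (Cantor.to_nat (code (mkseq p m),
     code (mkseq (fun i => (nth 0 (decode (nth 0 s 0)) (n.+2 + i))./2) m))) == 1)
     (iota 0 (size (decode (nth 0 s 0)) - n.+1)))
   (iota 0 (size (decode (nth 0 s 0))).-1))).
  move=> p s; congr nat_of_bool; apply: eq_all => n; congr (_ ==> _).
  by apply: eq_all => m; rewrite size_mkseq.
rewrite -/(recp _ _).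
repeat first [apply: recf_code_mkseq | progress rec_solve].
Qed.

(** * Finite parts of names of closed sets *)

Definition name_prefix (r : seq nat) : Prop := exists q T,
  [/\ is_tree T, is_charfun q T & mkseq q (size r) = r].

(** Take the prefixes of points of [C] together with the strings that [r] accepts and their
    prefixes. The latter are finitely many and add no branch; the strings rejected by [r] stay out
    because their cones miss [C]. *)
Lemma name_prefix_extend r (C : closed_set) : name_prefix r ->
  (forall s, s < size r -> nth 0 r s = 0 -> ~ (sval C `&` cone (decode s) !=set0)) ->
  exists2 q, tree_name q C & mkseq q (size r) = r.
Proof.
move=> [q [T [treeT qT qr]]] avoid.
have [[t0 Tt0] prefT] := treeT.
pose S : set (seq nat) := [set s | s = [::] \/
  (exists2 x, sval C x & cone s x) \/
  (exists t, [/\ code t < size r, T t & prefix s t])].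
pose q' : baire := fun n => nat_of_bool `[< S (decode n) >].
exists q'; last first.
  rewrite -[RHS]qr; apply/mkseq_eqP => n nr.
  rewrite /q' -[in RHS](CodeSeq.decodeK n) qT.
  congr nat_of_bool; apply/asbool_equiv_eq; split; last first.
    by move=> Tn; right; right; exists (decode n); rewrite CodeSeq.decodeK prefix_refl.
  move=> [->|[[x Cx xn]|[t [_ Tt nt]]]].
  - exact: prefT (prefix0s _) Tt0.
  - apply: contrapT => nTn; apply: (avoid n nr); last by exists x.
    by rewrite -qr nth_mkseq// -[n]CodeSeq.decodeK qT asboolF.
  - exact: prefT nt Tt.
exists S; split.
- split; first by exists [::]; left.
  move=> s t st [tE|[[x Cx xt]|[u [ur Tu tu]]]].
  + by left; move: st; rewrite tE prefixs0 => /eqP.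
  + by right; left; exists x => //; exact: cone_sub st _ xt.
  + by right; right; exists u; split=> //; exact: prefix_trans st tu.
- by move=> s; rewrite /q' CodeSeq.codeK.
apply/seteqP; split=> [x xS|x Cx n]; last first.
  by right; left; exists x => //; exact: cone_mkseq.
apply: (closed_baireP _).1 (svalP C) _ _ => n.
(* Strings longer than [M] can only be prefixes of points of [C]. *)
pose M := \max_(i < size r) size (decode i).
have [N nN MN] : exists2 N, n <= N & M < N.
  by exists (maxn n M).+1; rewrite ?ltnS ?leq_maxr// leqW// leq_maxl.
have := xS N => -[/(congr1 size)|[[y Cy]|[t [tr _ /size_prefix]]]].
- by rewrite size_mkseq /= => N0; rewrite N0 in MN.
- rewrite /cone /= size_mkseq => /mkseq_eqP yx; exists y => //.
  by apply/mkseq_eqP => i ilt; apply: yx; exact: leq_trans nN.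
- have := leq_bigmax (F := fun i : 'I_(size r) => size (decode i)) (Ordinal tr).
  rewrite -/M /= CodeSeq.codeK size_mkseq; lia.
Qed.

Lemma ScList_not_le_PK : ~ ScList <=_W PK.
Proof.
move=> [Phi [Psi [[cPhi cPhiP] [cPsi cPsiP] red]]].
pose name x := fan_name (diag_check x).
have nameC x n : exists N, forall x', mkseq x' N = mkseq x N ->
    mkseq (name x') n = mkseq (name x) n.
  apply: continuous_upto => {}n.
  exact: (recf_continuous x recf_diag_name (erefl : size [:: n] = 1)).
have /choice[phi phiP] : forall x, exists p', Phi (name x) = Some p' /\
    exists U C, [/\ tree_name p' U, PK U C & forall q, tree_name q C ->
      exists q', Psi (interleave (name x) q) = Some q' /\
        (q' 0 = 1 <-> forall c, branches (diag_check x) c !=set0)].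
  move=> x; have [p' [U [E p'U [C UC] sol]]] :=
    red _ _ (tree_name_fan (diag_check x)) (dom_ScList_fan _).
  exists p'; split=> //; exists U, C; split=> // q qC.
  have [q' [y [E' [y1 _] /ScList_fanP[_ yE]]]] := sol q C qC UC.
  by exists q'; split=> //; rewrite -yE -y1.
have phiC x n : exists N, forall x', mkseq x' N = mkseq x N -> phi x' n = phi x n.
  have phi_eval x' := cPhiP _ _ (phiP x').1 n.
  have [M MP] := eval_continuous (phi_eval x); have [N NP] := nameC x M.
  by exists N => x' /NP/MP; exact: eval_functional (phi_eval x').
(* The parts [r] of [q] and of equal length of [x] force the answer 1. Quantifying over [x'] makes
   this depend on finitely many entries of [x], as closedness of [K] requires. *)
pose out1 x r := forall x' q, mkseq x' (size r) = mkseq x (size r) ->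
  mkseq q (size r) = r -> eval (interleave (name x') q) cPsi [:: 0] 1.
(* Either [r] does not force the answer 1, or [r] wrongly rejects a string [s] whose cone meets the
   kernel, as the scheme in [g] shows. *)
pose witness x r (g : nat -> nat) := (g 0 = 0 /\ ~ out1 x r) \/ exists s,
  [/\ g 0 = s.+1, s < size r, nth 0 r s = 0 & scheme (phi x) s (fun i => g i.+1)].
pose K x f := forall r, name_prefix r -> witness x r (row f (code r)).
have witnessE x : (exists f, K x f) <-> ~ forall c, branches (diag_check x) c !=set0.
  have [_ [U [C [[T [treeT pT TU]] UC sol]]]] := phiP x.
  move: UC; rewrite /PK /= -TU => kerC.
  split=> [[f Kxf] ill|wf].
    (* Were the answer 1, some part [r] of a true name [q] of the kernel would force it; its witness
       would then be a scheme above a string that [q] rightly rejects. *)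
    have [q [S [treeS qS SC]]] := tree_name_surjective C.
    have [|q' [Eq' /iffRL/(_ ill) q'1]] := sol q; first by exists S.
    have := cPsiP _ _ Eq' 0; rewrite q'1 => /eval_continuous[N NP].
    have [M MP] := nameC x N; pose r := mkseq q (maxn M N).
    have rE : size r = maxn M N by rewrite size_mkseq.
    have : name_prefix r by exists q, S; rewrite rE.
    case/Kxf => [[_]|[s [_ sr rs fs]]].
      apply=> x' q1; rewrite rE => /mkseq_eqP x'x /mkseq_eqP q1q; apply: NP.
      have /MP/mkseq_eqP name_x' : mkseq x' M = mkseq x M.
        by apply/mkseq_eqP => i iM; rewrite x'x// leq_max iM.
      apply/mkseq_eqP => i iN; rewrite /interleave; case: odd.
        by rewrite q1q// leq_max; lia.
      by rewrite name_x'//; lia.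
    have /(perfect_kernel_meets_cone _ treeT pT kerC)[y [Cy ys]] :
      exists f, scheme (phi x) s f by eexists; exact: fs.
    have : S (decode s) by rewrite -ys; move: Cy; rewrite -SC; apply.
    move/(charfunE qS); move: rs; rewrite nth_mkseq -?rE// => ->.
    by [].
  have /choice[g gP] : forall r, exists g, name_prefix r -> witness x r g.
    move=> r; have [out|nout] := pselect (out1 x r); last by exists (fun=> 0); left.
    have [pre|npre] := pselect (name_prefix r); last by exists (fun=> 0).
    (* Otherwise [r] extends to a name of the kernel, on which the forced answer 1 would be
       correct. *)
    suff [s [sr rs /(perfect_kernel_meets_cone _ treeT pT kerC)[f fs]]] :
        exists s, [/\ s < size r, nth 0 r s = 0 & sval C `&` cone (decode s) !=set0].
      by exists (fun i => if i is j.+1 then f j else s.+1) => _; right; exists s.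
    apply: contrapT => /forallNP avoid; apply: wf.
    have [|q qC qr] := name_prefix_extend (C := C) pre.
      by move=> s sr rs Cs; apply: (avoid s).
    have [q' [Eq' /iffLR]] := sol q qC; apply.
    exact: eval_functional (cPsiP _ _ Eq' 0) (out x q erefl qr).
  exists (fun n => g (decode (Cantor.of_nat n).1) (Cantor.of_nat n).2) => r pre.
  rewrite (_ : row _ _ = g r); first exact: gP.
  by apply/funext => i; rewrite /row Cantor.cancel_of_to /= CodeSeq.codeK.
have [|x0 x0P] := diagonal (K := K).
  move=> x f approx r pre.
  (* [K] is closed: [g 0] fixes which alternative the approximating witnesses take, and each
     condition involves finitely many entries, for schemes by continuity of [phi]. *)
  have near N : exists x' g', [/\ witness x' r g', mkseq x' N = mkseq x N &
      forall i, i <= N -> g' i = row f (code r) i].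
    pose B := (maxn N (\max_(i < N.+1) Cantor.to_nat (code r, nat_of_ord i))).+1.
    have [x' [f' [K' /mkseq_eqP x'x /mkseq_eqP f'f]]] := approx B.
    exists x', (row f' (code r)); split; first exact: K'.
      by apply/mkseq_eqP => i iN; apply: x'x; rewrite /B; lia.
    move=> i iN; apply: f'f; rewrite /B ltnS leq_max.
    by apply/orP; right; apply: (leq_bigmax (F := fun i : 'I_N.+1 =>
      Cantor.to_nat (code r, nat_of_ord i)) (Ordinal (iN : i < N.+1))).
  set g := row f (code r) in near *.
  case E : (g 0) => [|s].
    left; split=> //; have [x' [g' [wit x'x g'g]]] := near (size r).
    case: wit => [[_ nout] out|[s []]]; last by rewrite g'g// E.
    by apply: nout => x1 q1; rewrite x'x; exact: out.
  right; exists s.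
  have near_scheme N : exists x' g', [/\ s < size r, nth 0 r s = 0,
      scheme (phi x') s (fun i => g' i.+1), mkseq x' N = mkseq x N &
      forall i, i <= N -> g' i = g i].
    have [x' [g' [wit x'x g'g]]] := near N.
    case: wit => [[]|[s' [+ sr rs fs]]]; rewrite g'g// E// => -[ss'].
    by exists x', g'; rewrite ss'.
  have [x1 [g1 [sr rs _ _ _]]] := near_scheme 0; split=> //; split.
    have [x2 [g2 [_ _ [pre0 _] _ g2g]]] := near_scheme 1.
    by rewrite -g2g.
  move=> k; have [N NP] := phiC x (g k.+1).
  have [x2 [g2 [_ _ [_ sch2] x2x g2g]]] := near_scheme (maxn N k.*2.+3).
  have phiE : phi x2 (g k.+1) = phi x (g k.+1).
    move/mkseq_eqP: x2x => x2x; apply: NP; apply/mkseq_eqP => i iN; apply: x2x.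
    by rewrite leq_max iN.
  by have := sch2 k; rewrite !g2g ?phiE//; lia.
(* For the diagonal point the branches are the [f] with [K x0 f], so their existence is equivalent
   both to [P] and to its negation. *)
have := witnessE x0; pose P := forall c, branches (diag_check x0) c !=set0.
have -> : (exists f, K x0 f) <-> P.
  split=> [[f Kf] c|/(_ 0)[f /x0P]]; last by exists f.
  by exists f; apply/x0P.
by rewrite -/P; tauto.
Qed.

Theorem theorem4p27 : PK <_W ScList.
Proof. by split; [exact: PK_le_ScList|exact: ScList_not_le_PK]. Qed.
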